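(* For any integer $k\geq 3$, any $k$-vertex graph $F$, any $0<\eta<\tfrac{\gamma(F)}{k}$ and any $\alpha>0$ the following holds for all sufficiently large $n\in \mathbb{N}$, where $\mu:=\tfrac{\gamma(F)}{k}-\eta>0$. There exists an $n$-vertex graph $G$ with $\delta(G)\ge \eta n$ and $\alpha(G)\le \alpha n$ such that every $F$-tiling in $G$ covers at most $(1-\mu)n$ vertices.
   Context: Graphs are finite and simple; $\delta(G)$ is the minimum degree and $\alpha(G)$ is the independence number of $G$. An $F$-tiling in $G$ is a collection of vertex-disjoint copies of $F$ in $G$ (not necessarily induced). For a graph $F$, $\gamma(F)$ denotes the minimum size of a subset $S\subset V(F)$ such that $F-S$ is acyclic (so $\gamma(F)=0$ if $F$ is acyclic, in which case the statement is vacuous). *)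

(* Defs.v *)
From mathcomp Require Import all_boot.

Set Implicit Arguments.
Unset Strict Implicit.
Unset Printing Implicit Defensive.

Record sgraph (V : finType) := SGraph {
  adj :> rel V;
  adj_sym : symmetric adj;
  adj_irrefl : irreflexive adj
}.

Section Invariants.
Variables (V : finType) (G : sgraph V).

Definition degree (v : V) : nat := #|[set w | G v w]|.

(* The default value #|V| exceeds every degree, so it matters only when V is
   empty. *)
Definition min_degree : nat := \big[minn/#|V|]_(v : V) degree v.

Definition independent (A : {set V}) : bool :=
  [forall x in A, forall y in A, ~~ G x y].

Definition independence_number : nat :=
  \max_(A : {set V} | independent A) #|A|.

(* Bounding the length by #|V| loses nothing, as the vertices of a cycle are
   distinct; see acyclicP. *)
Definition acyclic : bool :=
  [forall m : 'I_#|V|.+1, forall c : m.-tuple V, (2 < m) ==> ~~ ucycleb G c].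

Lemma acyclicP : reflect (forall c : seq V, 2 < size c -> ~ ucycle G c) acyclic.
Proof.
apply: (iffP forallP) => [acG c c_gt2 Gc | acG m].
  have c_le : size c < #|V|.+1 by rewrite ltnS -(card_uniqP (andP Gc).2) max_card.
  have /forallP/(_ (in_tuple c)) := acG (Ordinal c_le).
  by rewrite c_gt2 /= [ucycleb _ _]Gc.
apply/forallP => c; apply/implyP => m_gt2; apply/negP.
by apply: acG; rewrite size_tuple.
Qed.

Lemma del_vertices_sym (S : {set V}) :
  symmetric (relpre (val : {x | x \notin S} -> V) G).
Proof. by move=> x y; apply: adj_sym. Qed.

Lemma del_vertices_irrefl (S : {set V}) :
  irreflexive (relpre (val : {x | x \notin S} -> V) G).
Proof. by move=> x; apply: adj_irrefl. Qed.

Definition del_vertices (S : {set V}) : sgraph {x | x \notin S} :=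
  SGraph (@del_vertices_sym S) (@del_vertices_irrefl S).

End Invariants.

(* The default value #|V| is the size of the admissible choice S = V. *)
Definition gamma (V : finType) (F : sgraph V) : nat :=
  \big[minn/#|V|]_(S : {set V} | acyclic (del_vertices F S)) #|S|.

Section Tilings.
Variables (V W : finType) (F : sgraph V) (G : sgraph W).

(* A copy of F in G, not necessarily induced, is the image of an embedding.
   Disjointness makes distinct members of a tiling distinct copies. *)
Definition embedding (f : {ffun V -> W}) : Prop :=
  injective f /\ (forall x y, F x y -> G (f x) (f y)).

Definition tiling (T : {set {ffun V -> W}}) : Prop :=
  (forall f, f \in T -> embedding f) /\
  (forall f g, f \in T -> g \in T -> f != g ->
     [disjoint f @: [set: V] & g @: [set: V]]).

Definition covered (T : {set {ffun V -> W}}) : {set W} :=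
  \bigcup_(f in T) f @: [set: V].

End Tilings.

(* Main.v *)
Require Import Defs.
From HB Require Import structures.
From mathcomp Require Import all_boot all_order all_algebra reals.
From mathcomp Require Import zify lra.
Set Implicit Arguments.
Unset Strict Implicit.
Unset Printing Implicit Defensive.

(* Take G to be a clique A on about eta n vertices joined completely to a
   graph H of girth larger than k with small independence number. A copy of F
   meets H in an acyclic graph, so it uses at least gamma(F) vertices of A;
   hence a tiling has at most |A| / gamma(F) members and covers about
   (k / gamma(F)) eta n vertices, which lies below (1 - mu) n with linear slack
   since eta < gamma(F) / k < 1.
   The graph H is Erdos's, in a bounded-degree model: join every vertex x to
   w_1(x), ..., w_d(x) for d random functions w_i. A set of linear size is
   independent with probability below 4^-n when d is a large constant, and the
   expected number of cycles of length at most k is bounded independently of n,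
   so isolating one vertex of each of them costs only a constant. *)

(** * Preliminaries on cycles and on counting functions *)

Lemma leq_card_bigcup (I T : finType) (P : pred I) (A : I -> {set T}) :
  #|\bigcup_(i | P i) A i| <= \sum_(i | P i) #|A i|.
Proof.
elim/big_rec2: _ => [|i m U _ IH]; first by rewrite cards0.
by apply: leq_trans (leq_add (leqnn _) IH); rewrite cardsU leq_subr.
Qed.

(** Rules out that a cycle of length at least three runs through one edge in both directions. *)
Lemma next_next_neq (T : eqType) (c : seq T) (x : T) :
  uniq c -> 2 < size c -> x \in c -> next c (next c x) != x.
Proof.
move=> Uc c_gt2 /rot_to[i s def_c].
have Ur : uniq (x :: s) by rewrite -def_c rot_uniq.
have r_gt2 : 2 < size (x :: s) by rewrite -def_c size_rot.
rewrite -!(next_rot i Uc) def_c.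
case: s Ur r_gt2 {def_c} => [|y [|z s]] //= /andP[xN _] _.
move: xN; rewrite !inE !negb_or => /and3P[xy xz _].
by rewrite !eqxx (eq_sym y) (negPf xy) eq_sym.
Qed.

Lemma card_ffun_family (I T : finType) (F : I -> pred T) :
  #|[set w : {ffun I -> T} | [forall i, w i \in F i]]| = \prod_i #|F i|.
Proof.
rewrite -[RHS]big_enum -(big_map (fun i => #|F i|) predT id) -foldrE -card_family.
by apply: eq_card => w; rewrite inE.
Qed.

(** Injectivity of [p] puts the constraints at distinct arguments, so each cuts the choices there
    from [#|T|] to one. *)
Lemma card_ffun_constraints (I J T : finType) (p : J -> I) (q : J -> T) :
  injective p ->
  #|[set w : {ffun I -> T} | [forall j, w (p j) == q j]]| * #|T| ^ #|J|
    <= #|T| ^ #|I|.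
Proof.
move=> p_inj.
pose F i : pred T := [pred z | [forall j, (p j == i) ==> (z == q j)]].
have -> : [set w : {ffun I -> T} | [forall j, w (p j) == q j]] =
          [set w : {ffun I -> T} | [forall i, w i \in F i]].
  apply/setP=> w; rewrite !inE; apply/forallP/forallP => /= Hw.
    by move=> i; apply/forallP=> j; apply/implyP=> /eqP<-.
  by move=> j; have /forallP/(_ j) := Hw (p j); rewrite eqxx.
rewrite card_ffun_family -(card_codom p_inj).
rewrite -[X in _ * X]prod_nat_const [X in _ * X]big_mkcond /=.
rewrite -[#|T| ^ _]prod_nat_const -big_split /=.
apply: leq_prod => i _; case: ifP => [/codomP[j ->]|_]; last first.
  by rewrite muln1 max_card.
rewrite -[leqRHS]mul1n leq_mul2r -(card1 (q j)); apply/orP; right.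
apply/subset_leq_card/subsetP => z; rewrite !inE => /forallP/(_ j).
by rewrite eqxx.
Qed.

(** * Graphs defined by [d] functions *)

Section FunctionalGraph.
Variables (T : finType) (d : nat).
Implicit Type w : {ffun 'I_d * T -> T}.

Definition functional_adj w : rel T := fun x y =>
  (x != y) && [exists l, (w (l, x) == y) || (w (l, y) == x)].

Lemma functional_adj_sym w : symmetric (functional_adj w).
Proof.
move=> x y; rewrite /functional_adj eq_sym; congr (_ && _).
by apply: eq_existsb => l; rewrite orbC.
Qed.

Lemma functional_adj_irrefl w : irreflexive (functional_adj w).
Proof. by move=> x; rewrite /functional_adj eqxx. Qed.

Definition functional_graph w : sgraph T :=
  SGraph (functional_adj_sym w) (functional_adj_irrefl w).

(** Each of the [d * #|S|] values [w (l, x)] with [x] in [S] must avoid [S] except [x] itself, which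
    leaves at most [#|T| - s] choices. *)
Lemma card_functional_independent (s : nat) (S : {set T}) :
  s < #|S| ->
  #|[set w | independent (functional_graph w) S]|
    <= (#|T| - s) ^ (d * s) * #|T| ^ (d * (#|T| - s)).
Proof.
move=> s_lt.
pose F (p : 'I_d * T) : pred T :=
  [pred z | (p.2 \in S) ==> ((z \notin S) || (z == p.2))].
have sub : [set w | independent (functional_graph w) S] \subset
           [set w : {ffun 'I_d * T -> T} | [forall p, w p \in F p]].
  apply/subsetP=> w; rewrite !inE => /forall_inP Sw.
  apply/forallP=> -[l x]; rewrite inE /=; apply/implyP=> xS.
  have [wS|//] := boolP (w (l, x) \in S); rewrite /=.
  have := forall_inP (Sw x xS) _ wS; rewrite /= /functional_adj.
  rewrite negb_and negbK eq_sym => /orP[//|/existsP[]].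
  by exists l; rewrite eqxx.
apply: leq_trans (subset_leq_card sub) _; rewrite card_ffun_family.
have S_le : #|S| <= #|T| := max_card _.
pose h x := if x \in S then #|T| - s else #|T|.
have F_le p : #|F p| <= h p.2.
  rewrite /h; case: ifP => pS; last exact: max_card.
  have /subset_leq_card : F p \subset p.2 |: ~: S.
    by apply/subsetP=> z; rewrite !inE pS /= orbC.
  move=> /leq_trans-> //; rewrite cardsU1 !inE pS cardsCs setCK add1n.
  exact: ltn_sub2l (leq_trans s_lt S_le) s_lt.
apply: leq_trans (leq_prod (fun p _ => F_le p)) _.
rewrite -(pair_bigA _ (fun _ x => h x)) /= prod_nat_const card_ord.
rewrite ![d * _]mulnC !expnM -expnMn.
have leX a b : a <= b -> a ^ d <= b ^ d by case: (d) => // d'; rewrite leq_exp2r.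
apply: leX; rewrite big_if /= !prod_nat_const.
have -> : #|[pred x | x \notin S]| = #|T| - #|S|.
  by rewrite -(cardC S) addKn.
move: #|S| #|T| s_lt S_le => m N s_lt m_le.
(* The [m - s] surplus factors [N - s] are relaxed to [N], so that the bound no longer depends on
   [#|S|]. *)
have -> : N ^ (N - s) = N ^ (m - s) * N ^ (N - m).
  by rewrite -expnD addnC addnBA ?subnK // ltnW.
rewrite -(subnKC (ltnW s_lt)) expnD addKn subnKC ?(ltnW s_lt) // mulnA.
by rewrite !leq_mul // leq_exp2r ?subn_gt0 // leq_subr.
Qed.

Lemma functional_adjP w x y :
  reflect (x != y /\ exists l b, w (l, if b then x else y) = if b then y else x)
          (functional_graph w x y).
Proof.
apply: (iffP andP) => -[xy H]; split=> //.
  by case/existsP: H => l /orP[] /eqP wl; exists l; [exists true | exists false].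
case: H => l [b wl]; apply/existsP; exists l.
by case: b wl => ->; rewrite eqxx ?orbT.
Qed.

(* At most [(2 * d) ^ j] choices of a label and a direction for each edge of
   [c]; for each choice the [j] arguments at which [w] is prescribed are
   distinct, because an edge of [c] is not traversed twice. *)
Lemma card_functional_ucycle (j : nat) (c : j.-tuple T) :
  2 < j ->
  #|[set w | ucycleb (functional_graph w) c]| * #|T| ^ j
    <= (2 * d) ^ j * #|T| ^ (d * #|T|).
Proof.
move=> j_gt2; have [Uc|NUc] := boolP (uniq c); last first.
  rewrite (eq_card0 (A := [set w | _])) // => w.
  by rewrite !inE /ucycleb (negPf NUc) andbF.
pose x i := tnth c i; pose y i := next c (tnth c i).
pose p (lab : {ffun 'I_j -> bool * 'I_d}) i :=
  ((lab i).2, if (lab i).1 then x i else y i).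
pose q (lab : {ffun 'I_j -> bool * 'I_d}) i := if (lab i).1 then y i else x i.
pose W lab := [set w : {ffun 'I_d * T -> T} | [forall i, w (p lab i) == q lab i]].
have sub : [set w | ucycleb (functional_graph w) c] \subset \bigcup_lab W lab.
  apply/subsetP=> w; rewrite inE => /andP[wc _].
  have /fin_all_exists[lab labP] i : exists lb : bool * 'I_d,
      w (lb.2, if lb.1 then x i else y i) = if lb.1 then y i else x i.
    have /functional_adjP[_ [l [b wl]]] := next_cycle wc (mem_tnth i c).
    by exists (b, l).
  apply/bigcupP; exists (finfun lab) => //; rewrite inE.
  by apply/forallP=> i; rewrite /p /q !ffunE; apply/eqP/labP.
have W_le lab : #|W lab| * #|T| ^ j <= #|T| ^ (d * #|T|).
  (* A member [w] of [W lab] forces equal arguments [p] to carry equal values [q]. Equal [p] and [q]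
     at two indices mean the same edge of the cycle, hence the same index. *)
  have [->|[w]] := set_0Vmem (W lab); first by rewrite cards0.
  rewrite inE => /forallP Ww.
  have := @card_ffun_constraints _ _ _ (p lab) (q lab).
  rewrite card_prod !card_ord; apply=> i i' eq_p.
  have eq_q : q lab i = q lab i' by rewrite -(eqP (Ww i)) eq_p (eqP (Ww i')).
  have x_inj : injective x by apply/tuple_uniqP.
  have y_inj i1 i2 : y i1 = y i2 -> i1 = i2.
    by move/(can_inj (prev_next Uc))/x_inj.
  have yyN i1 i2 : y i1 = x i2 -> y i2 != x i1.
    move=> E; rewrite {1}/y -/(x i2) -E.
    by apply: next_next_neq; rewrite ?size_tuple ?mem_tnth.
  move: eq_p eq_q => [_]; rewrite /q.
  case: (lab i).1; case: (lab i').1; [by move/x_inj | | | by move/y_inj].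
    by move=> E1 E2; have := yyN _ _ E2; rewrite E1 eqxx.
  by move=> E1 E2; have := yyN _ _ E1; rewrite -E2 eqxx.
have le := leq_trans (subset_leq_card sub) (leq_card_bigcup _ _).
apply: leq_trans (_ : (\sum_lab #|W lab|) * #|T| ^ j <= _).
  by rewrite leq_mul2r le orbT.
rewrite big_distrl /=; apply: (@leq_trans (\sum_lab #|T| ^ (d * #|T|))).
  by apply: leq_sum => lab _; apply: W_le.
by rewrite sum_nat_const card_ffun card_prod card_bool !card_ord.
Qed.

End FunctionalGraph.

(** * Destroying short cycles *)

Section ShortCycles.
Variables (T : finType) (k : nat) (G : sgraph T).

(** The index [j] encodes length [j.+1], so lengths 3 to [k] occur. As rotations of a cycle are
    cycles, these are all the vertices on short cycles. *)
Definition short_cycle_heads : {set T} :=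
  \bigcup_(j < k | 1 < j) [set thead c | c : j.+1.-tuple T & ucycleb G c].

Lemma leq_card_short_cycle_heads :
  #|short_cycle_heads|
    <= \sum_(j < k | 1 < j) #|[set c : j.+1.-tuple T | ucycleb G c]|.
Proof.
apply: leq_trans (leq_card_bigcup _ _) _; apply: leq_sum => j _.
apply: leq_trans (leq_imset_card _ _) _.
by apply/subset_leq_card/subsetP => c; rewrite !inE.
Qed.

Lemma mem_short_cycle_heads x c :
  1 < size c < k -> ucycle G (x :: c) -> x \in short_cycle_heads.
Proof.
case/andP=> c_gt1 c_lt Gc; apply/bigcupP; exists (Ordinal c_lt) => //.
by apply/imsetP; exists [tuple of x :: in_tuple c]; rewrite ?theadE ?inE.
Qed.

End ShortCycles.

Section Isolate.
Variables (T : finType) (G : sgraph T) (D : {set T}).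

Definition isolate_adj : rel T :=
  fun x y => [&& G x y, x \notin D & y \notin D].

Lemma isolate_adj_sym : symmetric isolate_adj.
Proof. by move=> x y; rewrite /isolate_adj adj_sym [(x \notin D) && _]andbC. Qed.

Lemma isolate_adj_irrefl : irreflexive isolate_adj.
Proof. by move=> x; rewrite /isolate_adj adj_irrefl. Qed.

Definition isolate : sgraph T := SGraph isolate_adj_sym isolate_adj_irrefl.

Lemma independence_number_isolate :
  independence_number isolate <= independence_number G + #|D|.
Proof.
apply/bigmax_leqP=> A /forall_inP indA.
rewrite -(cardsID D A) addnC leq_add ?subset_leq_card ?subsetIr //.
apply: (leq_bigmax_cond (F := fun S : {set T} => #|S|)).
apply/forall_inP=> x /setDP[xA xD]; apply/forall_inP=> y /setDP[yA yD].
by have := forall_inP (indA x xA) y yA; rewrite /= /isolate_adj xD yD !andbT.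
Qed.

End Isolate.

(** A surviving short cycle would be one of [G] too, so its head would be isolated and yet have a
    neighbour. *)
Lemma isolate_short_cycle_heads (T : finType) (k : nat) (G : sgraph T) c :
  2 < size c <= k -> ~ ucycle (isolate G (short_cycle_heads k G)) c.
Proof.
case: c => [//|x c] c_size /andP[Hc Uc].
have /and3P[_ /negP xD _] := next_cycle Hc (mem_head x c); apply: xD.
apply: (@mem_short_cycle_heads _ k _ x c c_size).
by rewrite /ucycle Uc andbT; apply: sub_cycle Hc => y z /and3P[].
Qed.

(** * First-moment argument and the sparse graph *)

Lemma four_expn_le (e : nat) : 0 < e -> 4 * e ^ (3 * e) <= e.+1 ^ (3 * e).
Proof.
move=> e_gt0; rewrite -(leq_pmul2l e_gt0).
(* Bernoulli's inequality [(1 + 1/e)^n >= 1 + n/e] with denominators cleared; at [n = 3 * e] the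
   right side is 4. *)
have bernoulli n : (e + n) * e ^ n <= e * e.+1 ^ n.
  elim: n => [|n IH]; first by rewrite !expn0 addn0.
  by rewrite !expnSr; nia.
have -> : e * (4 * e ^ (3 * e)) = (e + 3 * e) * e ^ (3 * e) by lia.
exact: bernoulli.
Qed.

Lemma exchange_sum_card (I J : finType) (r : I -> J -> bool) :
  \sum_i #|[set j | r i j]| = \sum_j #|[set i | r i j]|.
Proof.
have E (A : finType) (P : pred A) : #|[set a | P a]| = \sum_a P a.
  by rewrite -sum1dep_card big_mkcond.
under eq_bigr do rewrite E; rewrite exchange_big /=.
by under eq_bigr do rewrite -E.
Qed.

Section RandomFunctionalGraph.
Variables (T : finType) (d k : nat).

(** There are [#|T| ^ j] tuples of length [j], each a cycle for a fraction at most
    [(2 * d) ^ j / #|T| ^ j] of the functions; the powers of [#|T|] cancel. *)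
Lemma sum_short_cycle_heads :
  \sum_(w : {ffun 'I_d * T -> T}) #|short_cycle_heads k (functional_graph w)|
    <= (\sum_(j < k) (2 * d) ^ j.+1) * #|T| ^ (d * #|T|).
Proof.
have [T0|T_gt0] := posnP #|T|.
  rewrite big1 // => w _; apply/eqP; rewrite -leqn0 -T0; exact: max_card.
apply: leq_trans.
  by apply: leq_sum => w _; apply: leq_card_short_cycle_heads.
rewrite exchange_big big_distrl /= [leqRHS](bigID (fun j : 'I_k => 1 < j)) /=.
apply: leq_trans (leq_addr _ _); apply: leq_sum => j j_gt1.
rewrite exchange_sum_card.
rewrite -(@leq_pmul2r (#|T| ^ j.+1)) ?expn_gt0 ?T_gt0 // big_distrl /=.
apply: leq_trans; first by apply: leq_sum => c _; apply: card_functional_ucycle.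
by rewrite sum_nat_const card_tuple mulnC.
Qed.

(* Both bad events are bounded by first moments: with [d = 3 * e * e.+1], at
   most a fraction [2 ^ (- #|T|)] of the functions have an independent set of
   more than [s] vertices, and Markov's inequality controls the short cycles. *)
Lemma exists_functional_graph (e s : nat) :
  0 < e -> 0 < #|T| -> s <= #|T| <= e.+1 * s -> d = 3 * e * e.+1 ->
  exists w : {ffun 'I_d * T -> T},
    independence_number (functional_graph w) <= s /\
    #|short_cycle_heads k (functional_graph w)|
      <= 2 * \sum_(j < k) (2 * d) ^ j.+1.
Proof.
move=> e_gt0 T_gt0 /andP[s_le T_le] d_def.
set C := \sum_(j < k) _; set Omega := #|T| ^ (d * #|T|).
have Omega_gt0 : 0 < Omega by rewrite expn_gt0 T_gt0.
pose bad := \bigcup_(S : {set T} | s < #|S|)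
  [set w : {ffun 'I_d * T -> T} | independent (functional_graph w) S].
pose many := [set w : {ffun 'I_d * T -> T} |
  2 * C < #|short_cycle_heads k (functional_graph w)|].
have many_le : (2 * C).+1 * #|many| <= C * Omega.
  apply: leq_trans sum_short_cycle_heads.
  rewrite [leqRHS](bigID (mem many)) /= mulnC -sum_nat_const.
  by apply: leq_trans (leq_addr _ _); apply: leq_sum => w; rewrite inE.
have bad_le : 2 * #|bad| <= Omega.
  set B := (#|T| - s) ^ (d * s) * #|T| ^ (d * (#|T| - s)).
  have bad_sum : #|bad| <= 2 ^ #|T| * B.
    apply: leq_trans (leq_card_bigcup _ _) _.
    apply: leq_trans.
      by apply: leq_sum => S; apply: card_functional_independent.
    rewrite sum_nat_const leq_mul2r -[in 2 ^ _]cardsT -card_powerset powersetT.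
    by rewrite cardsT max_card orbT.
  have B_le : 4 ^ #|T| * B <= Omega.
    have -> : Omega = #|T| ^ (d * s) * #|T| ^ (d * (#|T| - s)).
      by rewrite -expnD -mulnDr subnKC.
    rewrite /B mulnA leq_mul2r; apply/orP; right.
    (* As [#|T| <= e.+1 * s], the ratio [(#|T| - s) / #|T|] is at most [e / e.+1]. Its power
       [3 * e * (e.+1 * s)] is at most [4 ^ (- (e.+1 * s))], hence at most [4 ^ (- #|T|)]. *)
    have ds : d * s = (3 * e) * (e.+1 * s) by rewrite d_def; lia.
    have e1_gt0 : 0 < e.+1 ^ (d * s) by rewrite expn_gt0.
    rewrite -(leq_pmul2r e1_gt0) -mulnA -!expnMn.
    have le1 : ((#|T| - s) * e.+1) ^ (d * s) <= (#|T| * e) ^ (d * s).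
      case: (d * s) => [//|m]; rewrite leq_exp2r // mulnBl leq_subLR.
      by rewrite (mulnS #|T|) leq_add2r mulnC.
    have le2 : 4 ^ #|T| * e ^ (d * s) <= e.+1 ^ (d * s).
      apply: (@leq_trans (4 ^ (e.+1 * s) * e ^ (d * s))).
        by rewrite leq_mul2r leq_pexp2l ?orbT.
      rewrite ds !(expnM _ (3 * e)) -expnMn.
      by case: (e.+1 * s) => [//|m]; rewrite leq_exp2r // four_expn_le.
    apply: leq_trans (leq_mul (leqnn _) le1) _.
    by rewrite !expnMn mulnCA leq_mul2l le2 orbT.
  have two : 2 <= 2 ^ #|T| by rewrite -{1}(expn1 2) leq_pexp2l.
  apply: leq_trans (leq_mul two bad_sum) _.
  by rewrite mulnA -expnMn.
(* [bad] contains at most half of the functions and [many] strictly less than half, since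
   [C / (2 * C).+1 < 1/2]. *)
have [w] : exists w, w \notin bad :|: many.
  apply/existsP; rewrite -negb_forall; apply/negP => /forallP all_in.
  have : Omega <= #|bad| + #|many|.
    apply: leq_trans (leq_card_setU _ _).
    rewrite /Omega -[X in d * X]/(#|T|) -{1}[d]card_ord -card_prod -card_ffun.
    by apply/subset_leq_card/subsetP=> w _.
  nia.
rewrite !inE negb_or -leqNgt => /andP[w_bad w_many]; exists w; split=> //.
apply/bigmax_leqP => S wS; rewrite leqNgt; apply: contra w_bad => S_gt.
by apply/bigcupP; exists S; rewrite ?inE.
Qed.

End RandomFunctionalGraph.

Lemma exists_sparse_graph (k e : nat) :
  0 < e ->
  exists n0, forall T : finType, n0 <= #|T| ->
    exists H : sgraph T,
      (forall c, 2 < size c <= k -> ~ ucycle H c) /\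
      e * independence_number H <= #|T|.
Proof.
move=> e_gt0; pose f := 2 * e; pose d := 3 * f * f.+1.
pose C := \sum_(j < k) (2 * d) ^ j.+1.
exists (f.+1 * (2 * C).+1 * 2).+2 => T T_ge.
have f_gt0 : 0 < f by rewrite muln_gt0.
pose s := (#|T| %/ f.+1).+1.
have s1 : s <= #|T| by rewrite ltn_Pdiv //; lia.
have s2 : #|T| <= f.+1 * s by rewrite mulnC ltnW // ltn_ceil.
have T_gt0 : 0 < #|T| by lia.
have := @exists_functional_graph T d k f s f_gt0 T_gt0.
rewrite s1 s2 => /(_ isT erefl)[w [ind_w heads_w]].
set G := functional_graph w in ind_w heads_w.
exists (isolate G (short_cycle_heads k G)); split.
  by move=> c c_size; apply: isolate_short_cycle_heads.
have := independence_number_isolate G (short_cycle_heads k G).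
have := leq_divM #|T| f.+1; rewrite -/C in heads_w *.
move: (independence_number _) => a s3 a_le.
have {}a_le : a <= #|T| %/ f.+1 + (2 * C).+1 by rewrite /s in ind_w; lia.
move: (#|T| %/ f.+1) s3 a_le T_ge => q; rewrite /f; nia.
Qed.

(** * Joining a clique to a sparse graph *)

Lemma leq_bigminn (I : finType) (P : pred I) (m a : nat) (h : I -> nat) :
  a <= m -> (forall i, P i -> a <= h i) -> a <= \big[minn/m]_(i | P i) h i.
Proof.
by move=> am ah; elim/big_ind: _ => // p q ap aq; rewrite leq_min ap aq.
Qed.

Lemma bigminn_leq (I : finType) (P : pred I) (m : nat) (h : I -> nat) j :
  P j -> \big[minn/m]_(i | P i) h i <= h j.
Proof.
move=> Pj; elim: (index_enum I) (mem_index_enum j) => //= i r IH.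
rewrite inE big_cons => /predU1P[<-|/IH le]; first by rewrite Pj geq_minl.
by case: ifP => _ //; apply: leq_trans (geq_minr _ _) le.
Qed.

Section CliqueJoin.
Variables (W : finType) (A : {set W}) (H : sgraph W).

Definition clique_join_adj : rel W :=
  fun x y => (x != y) && [|| x \in A, y \in A | H x y].

Lemma clique_join_adj_sym : symmetric clique_join_adj.
Proof.
by move=> x y; rewrite /clique_join_adj eq_sym adj_sym orbCA.
Qed.

Lemma clique_join_adj_irrefl : irreflexive clique_join_adj.
Proof. by move=> x; rewrite /clique_join_adj eqxx. Qed.

Definition clique_join : sgraph W :=
  SGraph clique_join_adj_sym clique_join_adj_irrefl.

Lemma min_degree_clique_join : #|A| < #|W| -> #|A| <= min_degree clique_join.
Proof.
move=> A_lt; apply: leq_bigminn => [|v _]; first exact: ltnW.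
have [vA|vA] := boolP (v \in A).
  have sub : [set~ v] \subset [set w | clique_join v w].
    by apply/subsetP=> w; rewrite !inE /= /clique_join_adj vA andbT eq_sym.
  apply: leq_trans (subset_leq_card sub).
  by rewrite -ltnS cardsC1 prednK // (leq_ltn_trans _ A_lt).
apply/subset_leq_card/subsetP=> w wA.
rewrite inE /= /clique_join_adj wA orbT andbT.
by apply: contraNneq vA => ->.
Qed.

(** An independent set that meets [A] is a singleton; one that avoids [A] is independent in [H]. *)
Lemma independence_number_clique_join :
  independence_number clique_join <= maxn 1 (independence_number H).
Proof.
apply/bigmax_leqP=> S /forall_inP indS; rewrite leq_max.
have adjN x y : x \in S -> y \in S -> x != y -> ~~ [|| x \in A, y \in A | H x y].
  move=> xS yS xy; have := forall_inP (indS x xS) y yS.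
  by rewrite /= /clique_join_adj xy.
have [disj|[x /setIP[xS xA]]] := set_0Vmem (S :&: A).
  have SA y : y \in S -> y \notin A.
    by move=> yS; apply/negP=> yA; have := in_set0 y; rewrite -disj inE yS yA.
  apply/orP; right; apply: (leq_bigmax_cond (F := fun U : {set W} => #|U|)).
  apply/forall_inP=> x xS; apply/forall_inP=> y yS.
  have [->|xy] := eqVneq x y; first by rewrite adj_irrefl.
  by have := adjN x y xS yS xy; rewrite (negPf (SA x xS)) (negPf (SA y yS)).
rewrite -(cards1 x) subset_leq_card //; apply/subsetP=> y yS; rewrite inE.
by apply/idPn=> yx; have := adjN y x yS xS yx; rewrite xA orbT.
Qed.

(** Outside the preimage [S] of [A], [f] maps edges of [F] to edges of [H], so a cycle there would
    give a cycle of [H] of the same length, at most [#|V|]. Hence [S] is admissible in [gamma]. *)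
Lemma gamma_le_embedding (V : finType) (F : sgraph V) (f : {ffun V -> W}) :
  (forall c, 2 < size c <= #|V| -> ~ ucycle H c) ->
  embedding F clique_join f -> gamma F <= #|f @: [set: V] :&: A|.
Proof.
move=> girthH [f_inj f_hom]; pose S := f @^-1: A.
have sub : f @: S \subset f @: [set: V] :&: A.
  by apply/subsetP=> _ /imsetP[x xS ->]; move: xS; rewrite !inE imset_f.
apply: leq_trans (subset_leq_card sub); rewrite card_imset //.
apply: (@bigminn_leq _ _ _ (fun U : {set V} => #|U|)).
apply/acyclicP=> c c_gt2 /andP[Fc Uc].
have val_inj_f : injective (f \o val : {x | x \notin S} -> W).
  by apply: inj_comp f_inj val_inj.
apply: (girthH (map (f \o val) c)).
  rewrite size_map c_gt2 -(size_map val).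
  by rewrite -(card_uniqP _) ?max_card // map_inj_uniq //; apply: val_inj.
rewrite /ucycle map_inj_uniq // Uc andbT cycle_map.
apply: sub_cycle Fc => x y Fxy.
have := f_hom _ _ Fxy; rewrite /= /clique_join_adj => /andP[_].
by have := valP x; have := valP y; rewrite !inE => /negPf-> /negPf->.
Qed.

(** Double counting of pairs of a copy and a vertex of [A] on it: each copy has at least [gamma F]
    such vertices, and by disjointness each vertex lies on at most one copy. *)
Lemma gamma_tiling_clique_join (V : finType) (F : sgraph V)
    (T : {set {ffun V -> W}}) :
  (forall c, 2 < size c <= #|V| -> ~ ucycle H c) ->
  tiling F clique_join T -> gamma F * #|covered T| <= #|V| * #|A|.
Proof.
move=> girthH [embT disjT].
have cov : #|covered T| <= #|T| * #|V|.
  apply: leq_trans (leq_card_bigcup _ _) _; rewrite -sum_nat_const.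
  by apply: leq_sum => f _; apply: leq_trans (leq_imset_card _ _) (max_card _).
apply: leq_trans (leq_mul (leqnn _) cov) _.
rewrite mulnA mulnC leq_mul2l; apply/orP; right.
rewrite mulnC -sum_nat_const.
apply: (@leq_trans (\sum_(f in T) #|f @: [set: V] :&: A|)).
  by apply: leq_sum => f fT; apply: gamma_le_embedding (embT f fT).
have E B : #|B :&: A| = \sum_(x in A) (x \in B).
  rewrite -sum1_card (eq_bigl (fun x => (x \in A) && (x \in B))); last first.
    by move=> x; rewrite inE andbC.
  by rewrite big_mkcondr.
under eq_bigr do rewrite E.
rewrite exchange_big -sum1_card /=; apply: leq_sum => x _.
rewrite -big_mkcondr sum1_card; apply/card_le1P=> f /andP[fT xf] g.
rewrite !inE; apply/andP/eqP=> [[gT xg]|->]; last by split.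
apply/eqP/idPn=> gf; have := disjT g f gT fT gf.
by rewrite -setI_eq0 => /eqP/setP/(_ x); rewrite !inE xf xg.
Qed.

End CliqueJoin.

(** * Choice of parameters *)

(** A single remaining vertex carries no cycle. This gives [x < 1] in the theorem, which makes the
    slack positive. *)
Lemma gamma_lt_card (V : finType) (F : sgraph V) : 0 < #|V| -> gamma F < #|V|.
Proof.
case/card_gt0P=> v _.
apply: (@leq_ltn_trans #|[set~ v]|); last first.
  by rewrite cardsC1 prednK //; apply/card_gt0P; exists v.
apply: (@bigminn_leq _ _ _ (fun U : {set V} => #|U|)).
apply/acyclicP=> -[|x [|y c]] //= _ /andP[_] /=; rewrite inE negb_or.
have eq_v (z : {x | x \notin [set~ v]}) : val z = v.
  by have := valP z; rewrite !inE negbK => /eqP.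
have -> : x = y by apply: val_inj; rewrite !eq_v.
by rewrite eqxx.
Qed.

Lemma exists_set_card (T : finType) (a : nat) :
  a <= #|T| -> exists A : {set T}, #|A| = a.
Proof.
case/card_geqP=> s [Us <- _]; exists [set x in s].
by rewrite cardsE; apply/card_uniqP.
Qed.

Import Order.TTheory GRing.Theory Num.Theory.
Local Open Scope ring_scope.

Theorem proposition1p9 (R : realType) (k : nat) (V : finType) (F : sgraph V)
    (eta alpha : R) :
  (3 <= k)%N -> #|V| = k ->
  0 < eta -> eta < (gamma F)%:R / k%:R ->
  0 < alpha ->
  let mu : R := (gamma F)%:R / k%:R - eta in
  exists n0 : nat, forall n : nat, (n0 <= n)%N ->
    exists G : sgraph 'I_n,
      [/\ eta * n%:R <= (min_degree G)%:R,
          (independence_number G)%:R <= alpha * n%:R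
        & forall T : {set {ffun V -> 'I_n}}, tiling F G T ->
            #|covered T|%:R <= (1 - mu) * n%:R].
Proof.
move=> k_ge3 cardV eta_gt0 eta_lt alpha_gt0 mu; rewrite {}/mu.
have k_gt0 : 0 < k%:R :> R by rewrite ltr0n; lia.
have := @gamma_lt_card _ F; rewrite cardV => /(_ (ltnW (ltnW k_ge3))) gamma_lt.
have gammaE : (gamma F)%:R = (gamma F)%:R / k%:R * k%:R :> R.
  by rewrite divfK // gt_eqF.
set x := _ / _ in eta_lt gammaE *.
have x_lt1 : x < 1 by rewrite ltr_pdivrMr // mul1r ltr_nat.
have large (c : R) : 0 < c ->
    exists m : nat, forall n, (m <= n)%N -> 1 < c * n%:R.
  move=> c_gt0; exists (Num.truncn c^-1).+1 => n mn.
  rewrite mulrC -ltr_pdivrMr // mul1r.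
  have /truncn_itv/andP[_] : 0 <= c^-1 by rewrite invr_ge0 ltW.
  by move=> /lt_le_trans; apply; rewrite ler_nat.
(* Since [alpha * e.+1 > 1], the bound [e.+1 * independence_number H <= n] puts that number below
   [alpha * n]; [n >= e] covers singletons. *)
have [e e_large] := large _ alpha_gt0.
have [n1 sparse] := @exists_sparse_graph k e.+1 isT.
have [n2 n2P] : exists m : nat, forall n, (m <= n)%N -> 1 < (1 - eta) * n%:R.
  by apply: large; lra.
(* By the identity [x * (1 - (x - eta)) - eta = (x - eta) * (1 - x)], this is the slack that absorbs
   the rounding error in [a]. *)
have [n3 n3P] : exists m : nat, forall n, (m <= n)%N ->
    1 < (x - eta) * (1 - x) * n%:R.
  by apply: large; rewrite mulr_gt0 // subr_gt0.
exists (e.+1 + n1 + n2 + n3)%N => n n_ge.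
have n_n1 : (n1 <= n)%N by lia.
have {}n2P : 1 < (1 - eta) * n%:R by apply: n2P; lia.
have {}n3P : 1 < (x - eta) * (1 - x) * n%:R by apply: n3P; lia.
have etan_ge0 : 0 <= eta * n%:R by rewrite mulr_ge0 // ltW.
(* Rounding up past [eta * n] secures the minimum degree and costs at most 1. *)
pose a := (Num.truncn (eta * n%:R)).+1.
have /andP[a_le a_gt] := truncn_itv etan_ge0.
have {}a_le : a%:R <= eta * n%:R + 1 by rewrite -natr1 lerD2r.
rewrite -/a in a_gt.
have a_lt : (a < n)%N by rewrite -(@ltr_nat R); lra.
have [A cardA] : exists A : {set 'I_n}, #|A| = a.
  by apply: exists_set_card; rewrite card_ord ltnW.
have [H [girthH indH]] : exists H : sgraph 'I_n,
    (forall c, (2 < size c <= k)%N -> ~ ucycle H c) /\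
    (e.+1 * independence_number H <= n)%N.
  by have := sparse 'I_n; rewrite card_ord => /(_ n_n1).
exists (clique_join A H); split.
- apply: ltW (lt_le_trans a_gt _); rewrite ler_nat -cardA.
  by apply: min_degree_clique_join; rewrite cardA card_ord.
- apply: le_trans (_ : (maxn 1 (independence_number H))%:R <= _).
    by rewrite ler_nat independence_number_clique_join.
  have n_gt1 : 1 < alpha * n%:R by apply: e_large; lia.
  case: leqP => _; last exact: ltW.
  have e_gt1 := ltW (e_large _ (leqnSn e)).
  move: indH; rewrite -(ler_nat R) natrM => /(ler_wpM2l (ltW alpha_gt0)).
  by apply: le_trans; rewrite mulrA ler_peMl.
- move=> T /gamma_tiling_clique_join; rewrite cardV cardA => /(_ girthH).
  rewrite -(ler_nat R) !natrM gammaE => cov_le.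
  have x_gt0 : 0 < x by lra.
  rewrite -(ler_pM2l x_gt0).
  have {}cov_le : x * #|covered T|%:R <= a%:R.
    by rewrite -(ler_pM2l k_gt0) mulrA [k%:R * x]mulrC.
  lra.
Qed.
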